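(* Let $t,k$ be integers with $t\ge 4$ and $k\ge\max\{6,t\}$. There exists a constant $\ell(t,k)$ such that for all integers $n\ge (t-1)(k-1)+1$, if $G$ is a $(K_t,\mathcal{T}_k)$-co-critical graph on $n$ vertices, then $$e(G)\ge\left(\frac{4t-9}{2}+\frac12\left\lceil\frac k2\right\rceil\right)n-\ell(t,k).$$
   Context: All graphs are finite and simple; $e(G)$ is the number of edges. $\mathcal{T}_k$ denotes the family of all trees on $k$ vertices. For a graph $G$ we write $G\to(K_t,\mathcal{T}_k)$ if every 2-coloring of $E(G)$ with colors red and blue contains a red $K_t$ or a blue copy of some tree in $\mathcal{T}_k$. A non-complete graph $G$ is $(K_t,\mathcal{T}_k)$-co-critical if $G\not\to(K_t,\mathcal{T}_k)$ but $G+e\to(K_t,\mathcal{T}_k)$ for every edge $e$ of the complement $\overline{G}$. *)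

(* Defs.v *)
From mathcomp Require Import all_boot.

Set Implicit Arguments.
Unset Strict Implicit.
Unset Printing Implicit Defensive.

Record sgraph (V : finType) := SGraph {
  adj :> rel V;
  adj_sym : symmetric adj;
  adj_irr : irreflexive adj
}.

Section Graphs.
Variable V : finType.
Implicit Types G : sgraph V.

Definition edges G : {set {set V}} :=
  [set [set p.1; p.2] | p : V * V & G p.1 p.2].

Definition complete_rel : rel V := fun x y => x != y.
Fact complete_sym : symmetric complete_rel.
Proof. by move=> x y; rewrite /complete_rel eq_sym. Qed.
Fact complete_irr : irreflexive complete_rel.
Proof. by move=> x; rewrite /complete_rel eqxx. Qed.
Definition complete : sgraph V := SGraph complete_sym complete_irr.

Definition is_complete G : Prop := forall x y, x != y -> G x y.

Definition compl_rel G : rel V := fun x y => (x != y) && ~~ G x y.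
Fact compl_sym G : symmetric (compl_rel G).
Proof. by move=> x y; rewrite /compl_rel eq_sym adj_sym. Qed.
Fact compl_irr G : irreflexive (compl_rel G).
Proof. by move=> x; rewrite /compl_rel eqxx. Qed.
Definition compl G : sgraph V := SGraph (compl_sym G) (compl_irr G).

(* The test x != y keeps the graph loopless even if e is a singleton. *)
Definition add_edge_rel G (e : {set V}) : rel V :=
  fun x y => G x y || ((x != y) && ([set x; y] == e)).
Fact add_edge_sym G e : symmetric (add_edge_rel G e).
Proof. by move=> x y; rewrite /add_edge_rel adj_sym eq_sym setUC. Qed.
Fact add_edge_irr G e : irreflexive (add_edge_rel G e).
Proof. by move=> x; rewrite /add_edge_rel adj_irr eqxx. Qed.
Definition add_edge G e : sgraph V :=
  SGraph (add_edge_sym G e) (add_edge_irr G e).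

(* A 2-colouring of the edges of G is a function c : {set V} -> bool, of which
   only the values on edges G matter; true is red and false is blue. *)
Definition color_rel G (c : {set V} -> bool) (b : bool) : rel V :=
  fun x y => G x y && (c [set x; y] == b).
Fact color_sym G c b : symmetric (color_rel G c b).
Proof. by move=> x y; rewrite /color_rel adj_sym setUC. Qed.
Fact color_irr G c b : irreflexive (color_rel G c b).
Proof. by move=> x; rewrite /color_rel adj_irr. Qed.
Definition color_class G c b : sgraph V :=
  SGraph (color_sym G c b) (color_irr G c b).

Definition connected G : Prop := 0 < #|V| /\ forall x y, connect G x y.

(* Cycles of a simple graph have length at least 3; ucycle alone also accepts
   [::] and an edge traversed back and forth. *)
Definition acyclic G : Prop := forall s : seq V, 2 < size s -> ~ ucycle G s.

Definition is_tree G : Prop := connected G /\ acyclic G.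

End Graphs.

(* G contains a copy of H as a (not necessarily induced) subgraph. *)
Definition contains (V W : finType) (G : sgraph V) (H : sgraph W) : Prop :=
  exists2 f : W -> V, injective f & forall x y, H x y -> G (f x) (f y).

(* G -> (K_t, T_k), the trees on k vertices being taken up to isomorphism on the
   vertex set 'I_k. *)
Definition arrows (V : finType) (G : sgraph V) (t k : nat) : Prop :=
  forall c : {set V} -> bool,
    contains (color_class G c true) (complete 'I_t) \/
    exists T : sgraph 'I_k, is_tree T /\ contains (color_class G c false) T.

Definition co_critical (V : finType) (G : sgraph V) (t k : nat) : Prop :=
  [/\ ~ is_complete G,
      ~ arrows G t k
    & forall e, e \in edges (compl G) -> arrows (add_edge G e) t k].

(* Main.v *)
From Stdlib Require Import Classical_Prop Classical_Pred_Type.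
Require Import Defs.
From mathcomp Require Import all_boot all_order all_algebra.
From mathcomp Require Import zify ring lra.

(** A critical colouring may be taken to be a vertex labelling [l] with fewer than
    [k] vertices per label, an edge being blue iff its ends have equal labels.  By
    edge-maximality the label classes are cliques of G, nonadjacent vertices have a
    red K_(t-2) in their common red neighbourhood, and all but boundedly many
    vertices lie in classes of size at least k/2; hence the blue edges contribute
    (ceil(k/2) - 1) n / 2, and 2(t-2) n red edges are needed.  By Hajnal's clique
    collection lemma, a vertex of red degree below 2(t-2) has a class of total
    degree at least n - 1, so either there are already enough edges or few such
    vertices.  Day's bootstrap percolation argument then gives 2(t-2) n - O(1) red
    edges; the red graph need not be saturated along blue edges, but each vertex has
    at most k - 2 blue neighbours, which can be absorbed in the percolating set. *)

Set Implicit Arguments.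
Unset Strict Implicit.
Unset Printing Implicit Defensive.

(** * Colourings as vertex labellings *)

(** Iterated parents lead to 0, which gives connectedness. On a cycle, both neighbours of the vertex
    of largest index would equal its parent. *)
Lemma parent_tree (k : nat) (p : nat -> nat) :
  0 < k -> (forall i, 0 < i < k -> p i < i) ->
  exists2 T : sgraph 'I_k, is_tree T &
    forall i j, T i j -> (0 < j) && (i == p j :> nat) || (0 < i) && (j == p i :> nat).
Proof.
move=> k_gt0 p_lt.
pose r (i j : 'I_k) := (i < j) && (i == p j :> nat).
pose e : rel 'I_k := fun i j => r i j || r j i.
have e_sym : symmetric e by move=> i j; rewrite /e orbC.
have e_irr : irreflexive e by move=> i; rewrite /e /r ltnn.
exists (SGraph e_sym e_irr) => /=; last first.
  move=> i j /orP[]/andP[lt ->]; rewrite andbT.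
    by rewrite (leq_ltn_trans _ lt).
  by rewrite (leq_ltn_trans _ lt) ?orbT.
split.
  have c0 i : connect e (Ordinal k_gt0) i.
    case: i => i; elim/ltn_ind: i => -[|i] IH ik.
      by rewrite (_ : Ordinal ik = Ordinal k_gt0) //; apply: val_inj.
    have lt : p i.+1 < i.+1 by apply: p_lt.
    apply: connect_trans (IH _ lt (ltn_trans lt ik)) (connect1 _).
    by rewrite /e /r /= lt eqxx.
  split; first by rewrite card_ord.
  move=> i j; apply: connect_trans (c0 j).
  by rewrite (sym_connect_sym e_sym).
move=> c c_gt2 /andP[cyc un].
have [m0 m0c] : exists m, m \in c by case: c c_gt2 {cyc un} => // m c; exists m; rewrite inE eqxx.
have [m mc m_max] := arg_maxnP (fun i : 'I_k => i : nat) m0c.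
have [i c' rc] := rot_to mc.
have sz : size c = (size c').+1 by rewrite -(size_rot i) rc.
have memc y : y \in m :: c' -> y <= m by rewrite -rc mem_rot; apply: m_max.
move: cyc un; rewrite -(rot_cycle i) -(rot_uniq i) rc /=.
case: c' sz rc memc => [|a [|b c']] sz rc memc; rewrite ?sz // in c_gt2 *.
rewrite /= rcons_path /= => /and3P[ema _ /andP[_ ezm]].
set z := last b c' in ezm.
have zb : z \in b :: c' by apply: mem_last.
have par y : y \in [:: m, a, b & c'] -> e m y || e y m -> y = p m :> nat.
  move=> /memc ym /orP[]/orP[]/andP[lt /eqP ->] //; by rewrite ltnNge ym in lt.
case/and3P=> _ /negP a_new _; apply: a_new.
rewrite (_ : a = z) //; apply: val_inj => /=.
rewrite (par a) ?ema ?inE ?eqxx ?orbT // (par z) ?ezm ?orbT //.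
by rewrite 2!inE zb !orbT.
Qed.

(** Grow the list along edges that leave it. If no edge leaves, the list contains the whole
    component, which is too large. The earlier neighbours serve as parents for [parent_tree]. *)
Lemma component_enum (V : finType) (G : sgraph V) (x : V) (k : nat) :
  0 < k <= #|[set y | connect G x y]| ->
  exists s : seq V, [/\ size s = k, uniq s, x \in s &
    forall i, 0 < i < k -> exists2 j, j < i & G (nth x s j) (nth x s i)].
Proof.
elim: k => // k IH /andP[_ k_lt]; case: (posnP k) => [-> | k_gt0].
  by exists [:: x]; split; rewrite ?inE //; case.
have /IH [s [sz un xs par]] : 0 < k <= #|[set y | connect G x y]| by rewrite k_gt0 ltnW.
have [/existsP[a /andP[a_s /existsP[b /andP[b_s Gab]]]] | /existsPn no_exit] :=
    boolP [exists a, (a \in s) && [exists b, (b \notin s) && G a b]].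
  exists (rcons s b); split; rewrite ?size_rcons ?sz ?rcons_uniq ?b_s ?mem_rcons ?inE ?xs ?orbT //.
  move=> i /andP[i_gt0]; rewrite ltnS leq_eqVlt => /predU1P[-> | i_lt].
    exists (index a s); first by rewrite -sz index_mem.
    by rewrite !nth_rcons sz ltnn eqxx -{1}sz index_mem a_s nth_index.
  have [|j ji Gji] := par i; first by rewrite i_gt0.
  by exists j => //; rewrite !nth_rcons sz i_lt (ltn_trans ji i_lt).
have cl : closed G (mem s).
  apply: intro_closed => [|a b Gab a_s]; first exact: sym_connect_sym (@adj_sym _ G).
  apply: contraT => b_s; case/negP: (no_exit a); rewrite a_s /=.
  by apply/existsP; exists b; rewrite b_s.
have /subset_leq_card : [set y | connect G x y] \subset s.
  by apply/subsetP => y; rewrite inE => /(closed_connect cl) <-.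
by rewrite (card_uniqP un) sz leqNgt k_lt.
Qed.

Lemma component_contains_tree (V : finType) (G : sgraph V) (x : V) (k : nat) :
  0 < k <= #|[set y | connect G x y]| ->
  exists2 T : sgraph 'I_k, is_tree T & contains G T.
Proof.
move=> kP; have [k_gt0 _] := andP kP; have [s [sz un _ par]] := component_enum kP.
(* The parent is the first neighbour in the list; [par] puts it before position [i]. *)
pose p i := find (fun a => G a (nth x s i)) s.
have pP i : 0 < i < k -> p i < i /\ G (nth x s (p i)) (nth x s i).
  move=> ik; have [j ji Gji] := par i ik; have [_ i_lt] := andP ik.
  have j_s : j < size s by rewrite sz (ltn_trans ji).
  have pj : p i <= j by rewrite leqNgt; apply/negP => /(before_find x); rewrite Gji.
  split; first exact: leq_ltn_trans ji.
  by apply: (@nth_find _ x (fun a => G a (nth x s i))); apply/(has_nthP x); exists j.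
have [T T_tree TP] := parent_tree k_gt0 (fun i ik => (pP i ik).1).
exists T => //; exists (fun i : 'I_k => nth x s i).
  move=> i j /eqP; rewrite nth_uniq ?sz // => /eqP; exact: val_inj.
move=> i j /TP /orP[]/andP[gt0 /eqP->]; last rewrite adj_sym.
  by apply: (pP _ _).2; rewrite gt0 ltn_ord.
by apply: (pP _ _).2; rewrite gt0 ltn_ord.
Qed.

Definition clique (V : finType) (e : rel V) (S : {set V}) : bool :=
  [forall x in S, forall y in S, (x != y) ==> e x y].

Lemma cliqueP (V : finType) (e : rel V) (S : {set V}) :
  reflect {in S &, forall x y, x != y -> e x y} (clique e S).
Proof.
apply: (iffP 'forall_in_forall_inP) => cl x y xS yS; last by apply/implyP/cl.
exact/implyP/cl.
Qed.

Lemma sub_clique (V : finType) (e : rel V) (A B : {set V}) :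
  A \subset B -> clique e B -> clique e A.
Proof.
move=> /subsetP sAB /cliqueP cl; apply/cliqueP => x y /sAB xB /sAB yB; exact: cl.
Qed.

Lemma contains_completeP (V : finType) (G : sgraph V) (t : nat) :
  contains G (complete 'I_t) <-> exists2 S : {set V}, clique G S & t <= #|S|.
Proof.
split=> [[f f_inj fG] | [S /cliqueP cl tS]].
  exists (f @: 'I_t); last by rewrite card_imset ?card_ord.
  by apply/cliqueP => _ _ /imsetP[i _ ->] /imsetP[j _ ->] ne; apply/fG/(contraNneq _ ne) => ->.
exists (fun i => enum_val (widen_ord tS i)) => [i j /enum_val_inj /(congr1 val) /= /val_inj //|].
move=> i j ne; apply: cl; rewrite ?enum_valP //.
by apply: contraNneq ne => /enum_val_inj /(congr1 val) /= /val_inj ->.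
Qed.

(* Enlarging the blue classes to whole label fibres is harmless, so a labelling
   encodes a colouring: an edge is blue iff its ends have equal labels. *)
Definition cross (V : finType) (G : rel V) (l : V -> V) : rel V :=
  fun x y => G x y && (l x != l y).

Definition fiber (V : finType) (l : V -> V) (x : V) : {set V} :=
  [set y | l y == l x].

Definition good_labelling (V : finType) (G : rel V) (t k : nat) (l : V -> V) :=
  (forall x, #|fiber l x| < k) /\
  (forall S, clique (cross G l) S -> #|S| < t).

(** Labelling each vertex by the root of its blue component can only shrink the red graph.
    Conversely, a tree that is blue in the colouring of a labelling is connected, so it lies in one
    fibre, which has fewer than [k] vertices. *)
Lemma arrowsPn (V : finType) (G : sgraph V) (t k : nat) : 0 < k ->
  ~ arrows G t k <-> exists l, good_labelling G t k l.
Proof.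
move=> k_gt0; split=> [nar | [l [l_fib l_cl]] ar].
  have [c /not_or_and[no_red no_blue]] := not_all_ex_not _ _ nar.
  set B := color_class G c false in no_blue.
  have B_sym := sym_connect_sym (@adj_sym _ B).
  exists (fingraph.root B); split=> [x | S /cliqueP cl].
    rewrite ltnNge; apply/negP => k_le; apply: no_blue.
    have [|T T_tree TB] := @component_contains_tree V B x k; last by exists T.
    rewrite k_gt0 (leq_trans k_le) // subset_leq_card //.
    by apply/subsetP => y; rewrite !inE (root_connect B_sym) B_sym.
  rewrite ltnNge; apply/negP => tS; apply: no_red; apply/contains_completeP.
  exists S => //; apply/cliqueP => x y xS yS /(cl _ _ xS yS) /andP[Gxy ne] /=.
  rewrite /color_rel Gxy; apply: contraNT ne => /negPf ne.
  apply/eqP/(fingraph.rootP B_sym)/connect1; rewrite /= /color_rel Gxy /=.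
  by case: (c _) ne.
pose c (e : {set V}) := [exists x in e, exists y in e, l x != l y].
have cE x y : c [set x; y] = (l x != l y).
  apply/idP/idP => [|ne].
    case/exists_inP => a /set2P[]-> /exists_inP[b /set2P[]->]; rewrite ?eqxx //.
    by rewrite eq_sym.
  by apply/exists_inP; exists x; rewrite ?set21 //; apply/exists_inP; exists y; rewrite ?set22.
case: (ar c) => [/contains_completeP[S /cliqueP cl tS] | [T [[[_ T_conn] _] [f f_inj fB]]]].
  suff /l_cl : clique (cross G l) S by rewrite ltnNge tS.
  apply/cliqueP => x y xS yS /(cl _ _ xS yS) /andP[Gxy].
  by rewrite cE /cross Gxy => /eqP->.
pose i0 := Ordinal k_gt0.
have lf i : l (f i) = l (f i0).
  have /connectP[p pth ->] := T_conn i0 i.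
  elim/last_ind: p pth => //= p j IH; rewrite rcons_path last_rcons => /andP[/IH <-].
  by move=> /fB /andP[_]; rewrite cE => /eqP/negbFE/eqP.
have := l_fib (f i0); rewrite ltnNge -(card_ord k) -(card_imset _ f_inj).
by case/negP; apply/subset_leq_card/subsetP => _ /imsetP[i _ ->]; rewrite inE lf.
Qed.

(** * Bootstrap percolation *)

Lemma card_bigcup_le (I V : finType) (S : {set I}) (A : I -> {set V}) (K : nat) :
  (forall i, i \in S -> #|A i| <= K) -> #|\bigcup_(i in S) A i| <= #|S| * K.
Proof.
move=> A_card; rewrite -sum_nat_const.
apply: (@leq_trans (\sum_(i in S) #|A i|)); last exact: leq_sum.
elim/big_rec2: _ => [|i n B _ le]; first by rewrite cards0.
by rewrite (leq_trans (leq_card_setU _ _).1) ?leq_add2l.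
Qed.

(** The size [1 + s + ... + s^h] of an [s]-ary branching tree of depth [h]. *)
Fixpoint avoid_bound (s h : nat) : nat :=
  if h is h'.+1 then (s * avoid_bound s h').+1 else 1.

(* A one-sided Bollobas set-pair bound: fix any y in B and branch on the element
   of D y that N x contains; that element lies in no D x of the same branch. *)
Lemma avoiding_subfamily (I V : finType) (N D : I -> {set V}) (s h : nat) (B : {set I}) :
  (forall b, b \in B -> [/\ #|D b| <= s, #|N b| <= h & [disjoint N b & D b]]) ->
  exists F : {set I}, [/\ F \subset B, #|F| <= avoid_bound s h &
    forall x, x \in B -> exists2 y, y \in F & [disjoint N x & D y]].
Proof.
elim: h N B => [|h IH] N B HB; (have [-> | [y yB]] := set_0Vmem B;
    first by exists set0; rewrite sub0set cards0; split=> // x; rewrite inE).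
  exists [set y]; rewrite sub1set cards1; split=> // x /HB[_ + _].
  rewrite leqn0 cards_eq0 => /eqP->; exists y; rewrite ?set11 //.
  by rewrite disjoints_subset sub0set.
pose Bw w := [set x in B | w \in N x].
have exF w : exists F : {set I}, [/\ F \subset Bw w,
    #|F| <= avoid_bound s h &
    forall x, x \in Bw w -> exists2 y, y \in F & [disjoint N x :\ w & D y]].
  apply: (IH (fun x => N x :\ w)) => x; rewrite inE => /andP[/HB[Ds Nh dis] wN].
  split=> //; first by rewrite (cardsD1 w) wN in Nh.
  by apply: disjointWl dis; apply: subD1set.
have [F FP] := fin_all_exists exF.
have [Dy _ _] := HB y yB.
exists (y |: \bigcup_(w in D y) F w); split.
- rewrite subUset sub1set yB; apply/bigcupsP => w _.
  have [sF _ _] := FP w; apply: (subset_trans sF); by apply/subsetP => x; rewrite inE => /andP[].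
- rewrite (leq_trans (leq_card_setU _ _).1) //= cards1 add1n ltnS.
  apply: leq_trans (card_bigcup_le (K := avoid_bound s h) _) _.
    by move=> w _; case: (FP w).
  by rewrite leq_mul2r Dy orbT.
move=> x xB; have [dis | /pred0Pn[w /andP[/= wN wD]]] := boolP [disjoint N x & D y].
  by exists y; rewrite ?setU11.
have [/subsetP sF _ /(_ x)] := FP w; rewrite inE xB wN => /(_ isT)[z zF dis].
exists z; first by rewrite inE; apply/orP; right; apply/bigcupP; exists w.
have := sF z zF; rewrite inE => /andP[/HB[_ _ disz] wz].
apply/pred0P => v /=; apply/negP => /andP[vN vD].
have [vw | vw] := eqVneq v w; first by rewrite -vw in wz; rewrite (disjointFr disz wz) in vD.
by rewrite (disjointFr dis) // in vD; rewrite !inE vw.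
Qed.

Definition degin (V : finType) (e : rel V) (P : {set V}) (x : V) : nat :=
  #|[set y in P | e x y]|.

Definition deg (V : finType) (e : rel V) (x : V) : nat := #|[set y | e x y]|.

Lemma degin_sub (V : finType) (e : rel V) (P Q : {set V}) (x : V) :
  P \subset Q -> degin e P x <= degin e Q x.
Proof.
by move=> /subsetP sPQ; apply/subset_leq_card/subsetP => y; rewrite !inE => /andP[/sPQ-> ->].
Qed.

Lemma deginC (V : finType) (e : rel V) (P : {set V}) (x : V) :
  degin e P x + degin e (~: P) x = deg e x.
Proof.
rewrite /degin /deg -(cardsID P [set y | e x y]).
by congr (_ + _); apply: eq_card => y; rewrite !inE // andbC.
Qed.

Lemma degin_sum (V : finType) (e : rel V) (P : {set V}) (x : V) :
  degin e P x = \sum_(y in P) e x y.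
Proof. by rewrite /degin -sum1dep_card big_mkcondr; apply: eq_bigr => y _; case: (e x y). Qed.

Lemma degin_exchange (V : finType) (e : rel V) (P Q : {set V}) :
  symmetric e -> \sum_(x in P) degin e Q x = \sum_(y in Q) degin e P y.
Proof.
move=> e_sym; under eq_bigr do rewrite degin_sum; rewrite exchange_big /=.
by apply: eq_bigr => y _; rewrite degin_sum; apply: eq_bigr => x _; rewrite e_sym.
Qed.

(* P spans at least d (#|P| - r) edges; sums of degrees count edges twice. *)
Definition spans (V : finType) (e : rel V) (d r : nat) (P : {set V}) : bool :=
  2 * d * #|P| <= \sum_(x in P) degin e P x + 2 * d * r.

(** Closure under the bootstrap rule that infects a vertex with [d] infected neighbours. *)
Definition percolated (V : finType) (e : rel V) (d : nat) (P : {set V}) : Prop :=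
  forall x, x \notin P -> degin e P x < d.

Lemma spansU (V : finType) (e : rel V) (d r : nat) (P A : {set V}) :
  spans e d r P -> spans e d (r + #|A|) (P :|: A).
Proof.
rewrite /spans => H.
have le1 : #|P :|: A| <= #|P| + #|A| by apply: (leq_card_setU _ _).1.
have le2 : \sum_(x in P) degin e P x <= \sum_(x in P :|: A) degin e (P :|: A) x.
  rewrite [leqRHS](bigID (mem P)) /= [X in _ <= X + _](eq_bigl (mem P)) => [|x]; last first.
    by rewrite !inE; case: (x \in P); rewrite ?andbF.
  by rewrite (leq_trans _ (leq_addr _ _)) //; apply: leq_sum => x _; apply/degin_sub/subsetUl.
have := leq_mul (leqnn (2 * d)) le1; lia.
Qed.

Lemma spans_add (V : finType) (e : rel V) (d r : nat) (P : {set V}) (v : V) :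
  symmetric e -> v \notin P -> d <= degin e P v -> spans e d r P -> spans e d r (v |: P).
Proof.
move=> e_sym vP dv; rewrite /spans cardsU1 vP big_setU1 //= => H.
have -> : \sum_(x in P) degin e (v |: P) x = degin e P v + \sum_(x in P) degin e P x.
  rewrite [degin e P v]degin_sum -big_split /=; apply: eq_bigr => x _.
  by rewrite !degin_sum big_setU1 //= e_sym.
have := degin_sub e v (subsetUr [set v] P); lia.
Qed.

(** The process is not iterated: a largest set containing [P :|: A] with the edge count is closed,
    since an infected vertex brings its own [d] edges. *)
Lemma percolation (V : finType) (e : rel V) (d r : nat) (P A : {set V}) :
  symmetric e -> spans e d r P ->
  exists Q : {set V}, [/\ P :|: A \subset Q, spans e d (r + #|A|) Q & percolated e d Q].
Proof.
move=> e_sym /(spansU A) H.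
pose ok : pred {set V} := fun Q => (P :|: A \subset Q) && spans e d (r + #|A|) Q.
have ok0 : ok (P :|: A) by rewrite /ok subxx.
have [Q /andP[sPQ Q_spans] Q_max] := arg_maxnP (fun Q : {set V} => #|Q|) ok0.
exists Q; split=> // v vQ; rewrite ltnNge; apply/negP => dv.
have /Q_max : ok (v |: Q).
  by rewrite /ok spans_add // andbT (subset_trans sPQ) ?subsetUr.
by rewrite cardsU1 vQ add1n /= ltnn.
Qed.

(** What the neighbours of [x] outside [P] still lack to become infected. For percolated [P] each
    term is positive, so a neighbour that enters the set also lowers the sum. *)
Definition potential (V : finType) (e : rel V) (d : nat) (P : {set V}) (x : V) : nat :=
  \sum_(w in ~: P | e x w) (d - degin e P w).

Lemma potential_lt (V : finType) (e : rel V) (d : nat) (P Q : {set V}) (x w : V) :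
  P \subset Q -> percolated e d P -> w \notin P -> e x w ->
  (w \in Q) || (degin e P w < degin e Q w) -> potential e d Q x < potential e d P x.
Proof.
move=> sPQ perc wP exw drop; have dw := perc w wP.
rewrite /potential [ltnRHS](bigD1 w) ?inE ?wP //=.
have le1 (A : {set V}) : A \subset ~: P ->
    \sum_(v in A | e x v && (v != w)) (d - degin e Q v) <=
    \sum_(v in ~: P | e x v && (v != w)) (d - degin e P v).
  move=> /subsetP sA; apply: (@leq_trans (\sum_(v in ~: P | e x v && (v != w)) (d - degin e Q v))).
    rewrite big_mkcond [leqRHS]big_mkcond; apply: leq_sum => v _.
    by have [/sA-> | //] := boolP (v \in A).
  by apply: leq_sum => v _; apply/leq_sub2l/degin_sub.
have sC : ~: Q \subset ~: P by rewrite setCS.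
have le := le1 _ sC.
rewrite [X in _ < _ + X](eq_bigl (fun v => (v \in ~: P) && (e x v && (v != w)))); last first.
  by move=> v; rewrite andbA.
have [wQ | wQ] := boolP (w \in Q).
  rewrite (eq_bigl (fun v => (v \in ~: Q) && (e x v && (v != w)))); first by lia.
  by move=> v; rewrite !inE; have [-> | ] := eqVneq v w; rewrite ?wQ ?andbT.
rewrite (bigD1 w) ?inE ?wQ //=.
rewrite [X in _ + X < _](eq_bigl (fun v => (v \in ~: Q) && (e x v && (v != w)))); last first.
  by move=> v; rewrite andbA.
move: drop; rewrite (negPf wQ) /=; lia.
Qed.

(** Each [y] outside [P] has a neighbour [z y] outside [P]. Absorbing [z y] for the few [y] in the
    subfamily [F] suffices: given [x], take [y] in [F] with [N x] and [D y] disjoint. Either [x] is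
    adjacent to [z y], or saturation gives a common neighbour [q] of [x] and [z y] not adjacent to
    [y]; then [q] is outside [P] and gains the neighbour [z y]. *)
Lemma percolation_step (V : finType) (e : rel V) (l : V -> V) (d K : nat) (P : {set V}) :
  symmetric e -> (forall x, #|fiber l x| <= K) ->
  (forall x y z, e y z -> x != z -> l x != l z -> ~~ e x z ->
     exists q, [/\ e x q, e z q & ~~ e y q]) ->
  percolated e d P -> (forall x, x \notin P -> d <= deg e x) ->
  exists2 A : {set V}, #|A| <= avoid_bound d d * K &
    forall (Q : {set V}) (x : V), P :|: A \subset Q -> x \notin Q ->
      potential e d Q x < potential e d P x.
Proof.
move=> e_sym l_fib sat perc min_deg.
(* Inside [P] the value [x] is only a default. *)
have out x : exists z, x \notin P -> (z \notin P) && e x z.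
  have [xP | xP] := boolP (x \in P); first by exists x.
  have : 0 < degin e (~: P) x.
    by have := min_deg x xP; have := perc x xP; have := deginC e P x; lia.
  by case/card_gt0P=> z; rewrite !inE; exists z.
have [z zP] := fin_all_exists out.
pose N x := [set q in P | e x q].
pose D y := [set q in P | e (z y) q] :\: N y.
have HB b : b \in ~: P -> [/\ #|D b| <= d, #|N b| <= d & [disjoint N b & D b]].
  rewrite inE => bP; split; last 1 first.
  - by apply/pred0P => q; rewrite !inE; case: (q \in P); case: (e b q).
  - have /andP[zbP _] := zP b bP.
    by rewrite (leq_trans _ (ltnW (perc _ zbP))) //; apply/subset_leq_card/subsetDl.
  - exact: ltnW (perc b bP).
have [F [/subsetP sF F_card F_cover]] := avoiding_subfamily HB.
(* Whole classes are absorbed, because saturation is assumed only for pairs with different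
   labels. *)
exists (\bigcup_(y in F) fiber l (z y)).
  apply: leq_trans (card_bigcup_le (K := K) _) _; first by move=> y _; apply: l_fib.
  by rewrite leq_mul2r F_card orbT.
move=> Q x; rewrite subUset => /andP[sPQ /bigcupsP sAQ] xQ.
have xP : x \notin P by apply: contra xQ => /(subsetP sPQ).
have [|y yF dis] := F_cover x; first by rewrite inE.
have yP := sF y yF; rewrite inE in yP; have /andP[zyP eyz] := zP y yP.
have sfQ := subsetP (sAQ y yF).
have zQ : z y \in Q by apply: sfQ; rewrite inE.
have lxz : l x != l (z y) by apply: contra xQ => lxz; apply: sfQ; rewrite inE.
have xz : x != z y by apply: contraNneq lxz => ->.
have [exz | exz] := boolP (e x (z y)).
  by apply: (potential_lt sPQ perc zyP exz); rewrite zQ.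
have [q [exq ezq eyq]] := sat x y (z y) eyz xz lxz exz.
have [qP | qP] := boolP (q \in P).
  have : q \in D y by rewrite !inE qP ezq (negPf eyq).
  by rewrite (disjointFr dis) // inE qP.
apply: (potential_lt sPQ perc qP exq); apply/orP; right.
apply: proper_card; apply/properP; split.
  by apply/subsetP => v; rewrite !inE => /andP[/(subsetP sPQ)-> ->].
by exists (z y); rewrite !inE ?zQ ?(negPf zyP) // e_sym.
Qed.

(* Day's argument for saturated graphs of prescribed minimum degree.  A vertex
   outside P with at least 2d edges, those into P counted twice, pays for itself;
   every other vertex loses potential each time P is enlarged. *)
Lemma min_degree_sum (V : finType) (e : rel V) (l : V -> V) (d K : nat) :
  symmetric e -> (forall x, #|fiber l x| <= K) ->
  (forall x y z, e y z -> x != z -> l x != l z -> ~~ e x z ->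
     exists q, [/\ e x q, e z q & ~~ e y q]) ->
  2 * d * #|V| <= \sum_x deg e x +
    2 * d * (#|[set x | deg e x < d]| + (2 * d * d).+1 * (avoid_bound d d * K)).
Proof.
move=> e_sym l_fib sat; set L := [set x | _]; set a := avoid_bound d d * K.
have rounds j : exists P : {set V}, [/\ L \subset P, spans e d (#|L| + j * a) P,
    percolated e d P & forall x, x \notin P -> degin e P x + deg e x < 2 * d ->
      potential e d P x + j <= 2 * d * d].
  elim: j => [|j [P [sLP P_spans perc pot]]].
    have s0 : spans e d 0 set0 by rewrite /spans cards0 muln0.
    (* Vertices of degree below [d] enter at the start: the percolation step needs degree at least
       [d] outside [P]. *)
    have [P [sLP P_spans perc]] := percolation L e_sym s0.
    exists P; rewrite set0U in sLP; rewrite mul0n addn0; split=> // x xP bad.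
    (* A deficient vertex has fewer than [2 * d] neighbours outside [P], each contributing at most
       [d]. *)
    rewrite addn0 /potential (@leq_trans (\sum_(w in ~: P | e x w) d)) //.
      by apply: leq_sum => w _; apply: leq_subr.
    rewrite sum_nat_cond_const -/(degin e (~: P) x) leq_mul2r; apply/orP; right.
    by have := deginC e P x; lia.
  have [|A A_card drop] := percolation_step e_sym l_fib sat perc.
    by move=> x xP; rewrite leqNgt; apply: contra xP => xL; apply: (subsetP sLP); rewrite inE.
  have [Q [sPAQ Q_spans Q_perc]] := percolation A e_sym P_spans.
  have sPQ : P \subset Q by apply: subset_trans sPAQ; apply: subsetUl.
  exists Q; split=> //; first exact: subset_trans sPQ.
    rewrite /spans in Q_spans *; apply: (leq_trans Q_spans).
    by rewrite leq_add2l leq_mul2l; apply/orP; right; rewrite mulSn /a; lia.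
  move=> x xQ bad; have := drop Q x sPAQ xQ.
  have xP : x \notin P by apply: contra xQ => /(subsetP sPQ).
  have := pot x xP; have := degin_sub e x sPQ; lia.
(* One round more than the initial potential allows, so no deficient vertex is left outside [P]. *)
have [P [_ P_spans _ pot]] := rounds (2 * d * d).+1.
have good x : x \in ~: P -> 2 * d <= degin e P x + deg e x.
  by rewrite inE => xP; rewrite leqNgt; apply/negP => /(pot x xP); lia.
have split_sum : \sum_x deg e x =
    \sum_(x in P) degin e P x + \sum_(x in ~: P) (degin e P x + deg e x).
  rewrite (bigID (mem P)) /= big_split /= addnA -degin_exchange //.
  rewrite -big_split /=; congr (_ + _); last by apply: eq_bigl => x; rewrite !inE.
  by apply: eq_bigr => x _; rewrite deginC.
have : \sum_(x in ~: P) 2 * d <= \sum_(x in ~: P) (degin e P x + deg e x).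
  exact: leq_sum.
rewrite sum_nat_const split_sum -(cardsC P) mulnDr [X in X <= _ -> _]mulnC.
move: P_spans; rewrite /spans; lia.
Qed.

(** * Cliques and edge counts *)

Lemma sub_set_card (V : finType) (S : {set V}) (n : nat) :
  n <= #|S| -> exists2 A : {set V}, A \subset S & #|A| = n.
Proof.
elim: n => [|n IH] nS; first by exists set0; rewrite ?sub0set ?cards0.
have [A sAS cA] := IH (ltnW nS).
have /properP[_ [x xS xA]] : A \proper S by rewrite properEcard sAS cA.
by exists (x |: A); rewrite ?subUset ?sub1set ?xS // cardsU1 xA cA.
Qed.

(* Hajnal's clique collection lemma. *)
Lemma clique_collection (V : finType) (e : rel V) (w : nat) (F : {set {set V}}) :
  F != set0 -> (forall A, A \in F -> clique e A /\ #|A| = w) ->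
  (forall B : {set V}, B \subset \bigcup_(A in F) A -> clique e B -> #|B| <= w) ->
  2 * w <= #|\bigcap_(A in F) A| + #|\bigcup_(A in F) A|.
Proof.
have [n] := ubnP #|F|; elim: n F => // n IH F Fn F0 FP w_max.
have [A AF] := set0Pn _ F0; have [A_cl A_card] := FP A AF.
pose F' := F :\ A; have AF' : A \notin F' by rewrite !inE eqxx.
have FE : F = A |: F' by rewrite setD1K.
rewrite FE !big_setU1 //= in w_max *.
have [F'0 | F'0] := eqVneq F' set0.
  by rewrite F'0 !big_set0 setIT setU0 A_card addnn -mul2n.
have /IH : #|F'| < n by move: Fn; rewrite FE cardsU1 AF'.
set I := \bigcap_(B in F') B; set U := \bigcup_(B in F') B => H.
have {H} IU : 2 * w <= #|I| + #|U|.
  apply: H => // [B /setD1P[_ /FP] // | B sBU].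
  by apply: w_max; rewrite (subset_trans sBU) ?subsetUr.
have I_in x B : x \in I -> B \in F' -> x \in B by move=> /bigcapP H /H.
have sIU : I \subset U.
  have [B BF'] := set0Pn _ F'0.
  by apply/subsetP => x xI; apply/bigcupP; exists B => //; apply: I_in.
have e_IU x y : x \in I -> y \in U -> x != y -> e x y && e y x.
  move=> xI /bigcupP[B BF' yB] ne; have xB := I_in _ _ xI BF'.
  have [|/cliqueP cl _] := FP B; first by case/setD1P: BF'.
  by rewrite !cl // eq_sym.
(* As this clique has at most [w] vertices, [#|A :&: U| + #|I| <= w + #|A :&: I|], which carries the
   bound from [F'] to [F]. *)
have B_cl : clique e ((A :&: U) :|: I).
  apply/cliqueP => x y /setUP[/setIP[xA xU] | xI] /setUP[/setIP[yA yU] | yI] ne.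
  - by move/cliqueP: A_cl; apply.
  - by rewrite eq_sym in ne; have /andP[] := e_IU y x yI xU ne.
  - by have /andP[] := e_IU x y xI yU ne.
  - by have /andP[] := e_IU x y xI (subsetP sIU _ yI) ne.
have /w_max /(_ B_cl) : (A :&: U) :|: I \subset A :|: U.
  by rewrite subUset (subset_trans (subsetIl _ _) (subsetUl _ _)) (subset_trans sIU) ?subsetUr.
rewrite !cardsU A_card -setIA (setIidPr sIU).
have : #|A :&: I| <= #|A :&: U| by apply/subset_leq_card/setIS.
have : #|A :&: I| <= #|I| by apply/subset_leq_card/subsetIr.
have : #|A :&: U| <= #|U| by apply/subset_leq_card/subsetIr.
lia.
Qed.

Lemma set2_eq (V : finType) (x y a b : V) :
  x != y -> [set x; y] = [set a; b] -> (x = a /\ y = b) \/ (x = b /\ y = a).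
Proof.
move=> ne E; have := set21 x y; have := set22 x y; rewrite E.
by case/set2P=> yE /set2P[] xE; rewrite ?xE ?yE ?eqxx in ne *; [|right|left|].
Qed.

Lemma sum_deg_le (V : finType) (G : sgraph V) : \sum_x deg G x <= 2 * #|edges G|.
Proof.
pose f (p : V * V) : {set V} := [set p.1; p.2].
pose E2 : {set V * V} := [set p | G p.1 p.2].
have -> : \sum_x deg G x = \sum_(p in E2) 1.
  rewrite [RHS](eq_bigl (fun p : V * V => G p.1 p.2)) => [|p]; last by rewrite inE.
  rewrite -(pair_big_dep xpredT (fun x y => G x y) (fun _ _ => 1)) /=.
  by apply: eq_bigr => x _; rewrite /deg sum1dep_card.
rewrite (partition_big f (mem (edges G))) /= => [|p]; last first.
  by rewrite inE => Gp; apply: imset_f; rewrite inE.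
rewrite mulnC -sum_nat_const; apply: leq_sum => _ /imsetP[[a b] + ->].
rewrite inE /= => Gab; rewrite sum1dep_card.
apply: (@leq_trans #|[set (a, b); (b, a)]|); last by rewrite cards2; case: (_ != _).
apply/subset_leq_card/subsetP => -[x y]; rewrite !inE /f /= => /andP[Gxy /eqP E].
have ne : x != y by apply: contraTneq Gxy => ->; rewrite adj_irr.
by case: (set2_eq ne E) => -[-> ->]; rewrite eqxx ?orbT.
Qed.

Lemma add_edgeP (V : finType) (G : sgraph V) (x y a b : V) :
  add_edge G [set x; y] a b -> [\/ G a b, a = x /\ b = y | a = y /\ b = x].
Proof.
case/orP=> [Gab | /andP[ne /eqP /(set2_eq ne)[]]];
  by [constructor 1 | constructor 2 | constructor 3].
Qed.

Lemma clique_cross_add_edge (V : finType) (G : sgraph V) (l : V -> V) (x y : V) (S : {set V}) :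
  clique (cross (add_edge G [set x; y]) l) S ->
  [|| x \notin S, y \notin S | l x == l y] -> clique (cross G l) S.
Proof.
move=> /cliqueP cl xyS; apply/cliqueP => a b aS bS ne.
have /andP[/add_edgeP[Gab | [ax by_] | [ay bx]] lab] := cl a b aS bS ne.
- by rewrite /cross Gab.
- by move: xyS; rewrite -ax -by_ aS bS (negPf lab).
- by move: xyS; rewrite -ay -bx aS bS eq_sym (negPf lab).
Qed.

Lemma good_labellingPn (V : finType) (G : rel V) (t k : nat) (l : V -> V) :
  (forall x, #|fiber l x| < k) -> ~ good_labelling G t k l ->
  exists2 S, clique (cross G l) S & t <= #|S|.
Proof.
move=> l_fib; have [/existsP[S /andP[cl tS]] | /existsPn none] :=
  boolP [exists S, clique (cross G l) S && (t <= #|S|)]; first by exists S.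
by case; split=> // S cl; have := none S; rewrite cl ltnNge.
Qed.

(** * Co-critical graphs *)

Lemma in_fiber (V : finType) (l : V -> V) (x y : V) : (y \in fiber l x) = (l y == l x).
Proof. by rewrite inE. Qed.

Lemma fiber_id (V : finType) (l : V -> V) (x : V) : x \in fiber l x.
Proof. by rewrite inE. Qed.

Lemma cross_sym (V : finType) (G : sgraph V) (l : V -> V) : symmetric (cross G l).
Proof. by move=> x y; rewrite /cross adj_sym eq_sym. Qed.

(** The labelling of the enlarged graph is arbitrary, so classes may later be merged and vertices
    moved. *)
Definition edge_maximal (V : finType) (G : sgraph V) (t k : nat) : Prop :=
  forall x y l, x != y -> ~~ G x y -> ~ good_labelling (add_edge G [set x; y]) t k l.

Lemma co_critical_maximal (V : finType) (G : sgraph V) (t k : nat) :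
  0 < k -> co_critical G t k -> edge_maximal G t k.
Proof.
move=> k_gt0 [_ _ crit] x y l ne Gxy l_good.
have /crit : [set x; y] \in edges (compl G).
  by apply/imsetP; exists (x, y); rewrite // inE /= /compl_rel ne.
by apply/arrowsPn => //; exists l.
Qed.

(** An edge added inside a class would be blue and create no red clique. *)
Lemma fiber_clique (V : finType) (G : sgraph V) (t k : nat) (l : V -> V) (x y : V) :
  edge_maximal G t k -> good_labelling G t k l -> x != y -> l x = l y -> G x y.
Proof.
move=> Gmax [l_fib l_cl] ne lxy; apply: contraT => Gxy; case: (Gmax x y l ne Gxy).
split=> // S cl; apply: l_cl; apply: clique_cross_add_edge cl _.
by rewrite lxy eqxx !orbT.
Qed.

(** With the labelling kept, adding the edge must create a red clique on [t] vertices through [x]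
    and [y]; remove these two. *)
Lemma common_clique (V : finType) (G : sgraph V) (t k : nat) (l : V -> V) (x y : V) :
  edge_maximal G t k -> good_labelling G t k l -> x != y -> ~~ G x y ->
  exists Q : {set V}, [/\ clique (cross G l) Q, #|Q| = t - 2 &
    forall q, q \in Q -> cross G l x q && cross G l y q].
Proof.
move=> Gmax [l_fib l_cl] ne Gxy.
have [S S_cl tS] := good_labellingPn l_fib (Gmax x y l ne Gxy).
have [xS yS] : x \in S /\ y \in S.
  apply/andP; apply: contraLR tS => /nandP xyS; rewrite -ltnNge.
  apply: l_cl; apply: clique_cross_add_edge S_cl _.
  by case: xyS => ->; rewrite ?orbT.
have cQ : t - 2 <= #|S :\ x :\ y|.
  by move: tS; rewrite (cardsD1 x S) xS (cardsD1 y (S :\ x)) !inE eq_sym ne yS; lia.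
have [Q sQ Q_card] := sub_set_card cQ; exists Q; split=> //.
  apply: sub_clique sQ _; apply: (clique_cross_add_edge (x := x) (y := y)).
    by apply: sub_clique S_cl; apply: subset_trans (subsetDl _ _) (subsetDl _ _).
  by rewrite !inE eqxx andbF.
move=> q /(subsetP sQ); rewrite !inE => /and3P[qy qx qS].
move/cliqueP: S_cl => cl.
have adjE z : z \in S -> q != z -> (z == x) || (z == y) -> cross G l z q.
  rewrite eq_sym => zS zq zxy; have /andP[/add_edgeP[Gzq | [_ qE] | [_ qE]] lzq] := cl z q zS qS zq.
  - by rewrite /cross Gzq.
  - by rewrite qE eqxx in qy.
  - by rewrite qE eqxx in qx.
by rewrite !adjE ?eqxx ?orbT.
Qed.

(** Otherwise the two classes could be merged: the added edge becomes blue and no edge turns red. *)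
Lemma fibers_large (V : finType) (G : sgraph V) (t k : nat) (l : V -> V) (x y : V) :
  edge_maximal G t k -> good_labelling G t k l -> x != y -> ~~ G x y ->
  k <= #|fiber l x| + #|fiber l y|.
Proof.
move=> Gmax [l_fib l_cl] ne Gxy; rewrite leqNgt; apply/negP => lt.
pose m z := if l z == l x then l y else l z.
case: (Gmax x y m ne Gxy); split=> [z | S cl].
  have [mz | mz] := eqVneq (m z) (l y).
    apply: leq_ltn_trans lt; apply: leq_trans (leq_card_setU _ _).1.
    apply/subset_leq_card/subsetP => v; rewrite !inE mz /m.
    by case: (l v == l x) => //= ->.
  apply: leq_ltn_trans (l_fib z); apply/subset_leq_card/subsetP => v; rewrite !inE.
  move: mz; rewrite /m; case: (l z =P l x); rewrite ?eqxx // => _ zy.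
  by case: (l v =P l x) => // _; rewrite eq_sym (negPf zy).
apply: l_cl; have /cliqueP cl' : clique (cross G m) S.
  by apply: clique_cross_add_edge cl _; rewrite /m eqxx; case: (l y == l x); rewrite ?eqxx ?orbT.
apply/cliqueP => a b aS bS ab; have /andP[Gab mab] := cl' a b aS bS ab.
by rewrite /cross Gab; apply: contraNneq mab => lab; rewrite /m lab.
Qed.

(** If [y] were joined in red to the whole common clique [Q] of [x] and [z], then [y], [z] and [Q]
    would form a red clique on [t] vertices. *)
Lemma cross_saturated (V : finType) (G : sgraph V) (t k : nat) (l : V -> V) (x y z : V) :
  edge_maximal G t k -> good_labelling G t k l ->
  cross G l y z -> x != z -> l x != l z -> ~~ cross G l x z ->
  exists q, [/\ cross G l x q, cross G l z q & ~~ cross G l y q].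
Proof.
move=> Gmax l_good yz ne lxz xz; have [_ l_cl] := l_good.
have Gxz : ~~ G x z by apply: contra xz => Gxz; rewrite /cross Gxz.
have [Q [Q_cl Q_card Q_adj]] := common_clique Gmax l_good ne Gxz.
have [/exists_inP[q qQ yq] | /exists_inPn all_y] := boolP [exists q in Q, ~~ cross G l y q].
  by have /andP[xq zq] := Q_adj q qQ; exists q.
have cross_irr u : cross G l u u = false by rewrite /cross adj_irr.
have yQ : y \notin Q by apply/negP => /all_y; rewrite cross_irr.
have zQ : z \notin Q by apply/negP => /Q_adj/andP[_]; rewrite cross_irr.
have yz_ne : y != z by apply: contraTneq yz => ->; rewrite cross_irr.
have : clique (cross G l) (y |: (z |: Q)).
  move/cliqueP: Q_cl => cl; apply/cliqueP => a b.
  have ay q : q \in Q -> cross G l y q by move=> /all_y; rewrite negbK.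
  have az q : q \in Q -> cross G l z q by move=> /Q_adj/andP[].
  rewrite !inE => /or3P[/eqP->|/eqP->|aQ] /or3P[/eqP->|/eqP->|bQ]; rewrite ?eqxx //.
  - by move=> _; apply: ay.
  - by rewrite cross_sym.
  - by move=> _; apply: az.
  - by move=> _; rewrite cross_sym; apply: ay.
  - by move=> _; rewrite cross_sym; apply: az.
  - exact: cl.
move/l_cl; rewrite !cardsU1 !inE negb_or yz_ne yQ zQ Q_card; lia.
Qed.

(* If every (t-2)-clique in the neighbourhood of v contains u and u is alone in
   its class, moving v into the class of u turns every nonedge between w and the
   class of v into one that can be added. *)
Lemma move_to_singleton (V : finType) (G : sgraph V) (t k : nat) (l : V -> V) (u v w : V) :
  2 < k -> good_labelling G t k l -> fiber l u = [set u] -> u != v ->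
  (forall A : {set V}, clique (cross G l) A -> #|A| = t - 2 ->
     (forall q, q \in A -> cross G l v q) -> u \in A) ->
  (forall b, b \in fiber l v -> ~~ G w b) ->
  exists m, good_labelling (add_edge G [set v; w]) t k m.
Proof.
move=> k_gt2 [l_fib l_cl] u_single uv hit w_far.
pose m z := if z == v then l u else l z; exists m.
have mv : m v = l u by rewrite /m eqxx.
have m_id z : z != v -> m z = l z by rewrite /m => /negPf->.
split=> [x | S S_cl].
  have [mx | mx] := eqVneq (m x) (l u).
    (* The new class of [u] is [[set u; v]]. *)
    apply: leq_ltn_trans k_gt2; apply: (@leq_trans #|[set u; v]|).
      apply/subset_leq_card/subsetP => z; rewrite in_fiber mx !inE.
      have [-> | zv] := eqVneq z v; rewrite ?orbT // m_id // -in_fiber u_single inE orbF //.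
    by rewrite cards2; case: (u != v).
  apply: leq_ltn_trans (l_fib x); apply/subset_leq_card/subsetP => z; rewrite !in_fiber.
  have xv : x != v by apply: contraNneq mx => ->; rewrite mv.
  have [-> | zv] := eqVneq z v; last by rewrite !m_id.
  by rewrite mv eq_sym (negPf mx).
have sub_l (A : {set V}) : v \notin A ->
    clique (cross (add_edge G [set v; w]) m) A -> clique (cross G l) A.
  move=> vA A_cl; have /cliqueP cl : clique (cross G m) A.
    by apply: clique_cross_add_edge A_cl _; rewrite vA.
  apply/cliqueP => a b aA bA ab; have := cl a b aA bA ab; rewrite /cross !m_id //.
    by apply: contraTneq bA => ->.
  by apply: contraTneq aA => ->.
have [vS | vS] := boolP (v \in S); last by apply: l_cl; apply: sub_l.
rewrite ltnNge; apply/negP => tS.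
(* A member of [J] is [w] or belongs to the old class of [v]. No two of these are joined in red
   after the move, so all but one vertex of [S :\ v] were red neighbours of [v] before it. *)
pose J := [set y in S :\ v | ~~ cross G l v y].
pose A0 := [set y in S :\ v | cross G l v y].
have /cliqueP cl := S_cl.
have vy y : y \in S :\ v -> y = w \/ G v y.
  move=> /setD1P[yv yS]; have /andP[+ _] : cross (add_edge G [set v; w]) m v y.
    by apply: cl; rewrite // eq_sym.
  by case/add_edgeP=> [->|[_ ->]|[_ yE]]; [right | left | rewrite yE eqxx in yv].
have J_in y : y \in J -> y != w -> l y = l v.
  rewrite inE => /andP[yS vyN] yw; case: (vy y yS) => [E | Gvy]; first by rewrite E eqxx in yw.
  by apply/eqP; apply: contraNT vyN => lyv; rewrite /cross Gvy eq_sym.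
have far y : y \in J -> y != w -> w \in J -> False.
  move=> yJ yw wJ; have lyv := J_in y yJ yw.
  move: (yJ) wJ; rewrite !inE => /andP[/andP[yv yS] _] /andP[/andP[wv wS] _].
  have wy : w != y by rewrite eq_sym.
  have /andP[/add_edgeP[Gwy | [wE _] | [_ yE]] _] := cl w y wS yS wy.
  - by have := w_far y; rewrite in_fiber lyv eqxx Gwy => /(_ isT).
  - by rewrite wE eqxx in wv.
  - by rewrite yE eqxx in yv.
have J_card : #|J| <= 1.
  apply/card_le1_eqP => y z yJ zJ.
  have [yw | yw] := eqVneq y w; have [zw | zw] := eqVneq z w.
  - by rewrite yw zw.
  - by case: (far z zJ zw); rewrite -yw.
  - by case: (far y yJ yw); rewrite -zw.
  apply/eqP; apply: contraT => yz; have lyv := J_in y yJ yw; have lzv := J_in z zJ zw.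
  move: yJ zJ; rewrite !inE => /andP[/andP[yv yS] _] /andP[/andP[zv zS] _].
  by have /andP[_] := cl z y zS yS yz; rewrite !m_id // lyv lzv eqxx.
have A0_card : t - 2 <= #|A0|.
  have : #|A0| + #|J| = #|S :\ v|.
    rewrite -(cardsID A0 (S :\ v)).
    congr (_ + _); apply: eq_card => y; rewrite !inE;
      by case: (y == v); case: (y \in S); case: (cross G l v y).
  by move: tS; rewrite (cardsD1 v S) vS; lia.
have [A sA A_card] := sub_set_card A0_card.
have sAS : A \subset S :\ v by apply: subset_trans sA _; apply/subsetP => y; rewrite inE => /andP[].
have vA : v \notin A by apply/negP => /(subsetP sAS); rewrite !inE eqxx.
have A_cl : clique (cross G l) A.
  by apply: sub_l => //; apply: sub_clique S_cl; apply: subset_trans sAS (subsetDl _ _).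
(* The contradiction: [u] and [v] now share a label, so no red clique contains both. *)
have /(subsetP sAS) : u \in A.
  by apply: hit => // q /(subsetP sA); rewrite inE => /andP[].
case/setD1P=> _ uS; have /andP[_] := cl u v uS vS uv.
by rewrite mv m_id // eqxx.
Qed.

(* A vertex whose neighbourhood in the cross graph has fewer than 2(t-2) vertices
   has a vertex u common to all (t-2)-cliques in it.  If a second vertex d shares the
   class of u, then d is a neighbour of v (else d and v have a common (t-2)-clique,
   which contains u) outside these cliques; this cannot happen for every such u. *)
Lemma low_degree_class (V : finType) (G : sgraph V) (t k : nat) (l : V -> V) (v : V) :
  2 < k -> edge_maximal G t k -> good_labelling G t k l ->
  deg (cross G l) v < 2 * (t - 2) ->
  #|V| <= (\sum_(b in fiber l v) deg G b).+1.
Proof.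
move=> k_gt2 Gmax l_good low; have [l_fib l_cl] := l_good.
set H := cross G l in low *.
(* If these sets cover [V], the bound follows by counting; otherwise some [w] is nonadjacent to the
   whole class of [v]. *)
pose reach := v |: \bigcup_(b in fiber l v) [set y | G b y].
have [w_all | [w]] : reach = setT \/ exists w, w \notin reach.
- have [E | /set0Pn[w wR]] := eqVneq (~: reach) set0; last by right; exists w; rewrite inE in wR.
  by left; rewrite -[reach]setCK E setC0.
- rewrite -cardsT -w_all (leq_trans (leq_card_setU _ _).1) // cards1 add1n ltnS.
  rewrite /deg; elim/big_rec2: _ => [|b n B _ le]; first by rewrite cards0.
  by rewrite (leq_trans (leq_card_setU _ _).1) ?leq_add2l.
rewrite !inE negb_or => /andP[wv w_far].
have {}w_far b : b \in fiber l v -> ~~ G w b.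
  move=> bv; apply: contra w_far; rewrite adj_sym => Gbw.
  by apply/bigcupP; exists b => //; rewrite inE.
have vw : v != w by rewrite eq_sym.
have Gvw : ~~ G v w by rewrite adj_sym; apply/w_far/fiber_id.
pose N := [set q | H v q].
pose F := [set A : {set V} | [&& clique H A, #|A| == t - 2 & A \subset N]].
have F0 : F != set0.
  have [Q [Q_cl Q_card Q_adj]] := common_clique Gmax l_good vw Gvw.
  apply/set0Pn; exists Q; rewrite inE -/H Q_cl Q_card eqxx.
  by apply/subsetP => q /Q_adj/andP[]; rewrite inE.
have FN : \bigcup_(A in F) A \subset N.
  by apply/bigcupsP => A; rewrite inE => /and3P[].
have v_max (B : {set V}) : B \subset N -> clique H B -> #|B| <= t - 2.
  move=> /subsetP BN /cliqueP cl.
  have vB : v \notin B by apply/negP => /BN; rewrite inE /H /cross adj_irr.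
  have : clique H (v |: B).
    apply/cliqueP => x y /setU1P[-> | xB] /setU1P[-> | yB]; rewrite ?eqxx // => ne.
    - by have := BN y yB; rewrite inE.
    - by rewrite /H cross_sym; have := BN x xB; rewrite inE.
    - exact: cl.
  by move/l_cl; rewrite cardsU1 vB; lia.
have haj : 2 * (t - 2) <= #|\bigcap_(A in F) A| + #|\bigcup_(A in F) A|.
  apply: clique_collection F0 _ _ => [A|B /subset_trans/(_ FN)]; last exact: v_max.
  by rewrite inE => /and3P[-> /eqP->].
set X := \bigcap_(A in F) A in haj; set U := \bigcup_(A in F) A in haj FN.
have XU : X \subset U.
  have [A AF] := set0Pn _ F0; apply/subsetP => x /bigcapP/(_ A AF) xA.
  by apply/bigcupP; exists A.
have Hv x : x \in U -> H v x by move/(subsetP FN); rewrite inE.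
have U_X u x : u \in X -> x \in U -> u != x -> H u x.
  move=> /bigcapP uX /bigcupP[A AF xA]; have := uX A AF.
  by move: AF; rewrite inE => /and3P[/cliqueP cl _ _] uA; apply: cl.
have [/exists_inP[u uX /eqP u_single] | /exists_inPn no_single] :=
    boolP [exists u in X, fiber l u == [set u]].
  have uv : u != v.
    by apply: contraTneq (Hv u (subsetP XU u uX)) => ->; rewrite /H /cross adj_irr.
  have hit (A : {set V}) : clique H A -> #|A| = t - 2 -> (forall q, q \in A -> H v q) -> u \in A.
    move=> A_cl A_card A_adj; have /bigcapP := uX; apply.
    by rewrite inE A_cl A_card eqxx; apply/subsetP => q /A_adj; rewrite inE.
  have [m m_good] := move_to_singleton k_gt2 l_good u_single uv hit w_far.
  by case: (Gmax v w m vw Gvw).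
have twin u : exists d, u \in X -> (d != u) && (l d == l u).
  have [uX | uX] := boolP (u \in X); last by exists u.
  have : fiber l u :\ u != set0.
    apply: contra (no_single u uX) => /eqP E.
    by rewrite -(setD1K (fiber_id l u)) E setU0.
  by case/set0Pn=> d; rewrite !inE => dP; exists d.
have [d dP] := fin_all_exists twin.
have d_new u : u \in X -> d u \notin U.
  move=> uX; have /andP[du /eqP ldu] := dP u uX; apply/negP => dU.
  by have := U_X u (d u) uX dU; rewrite eq_sym => /(_ du); rewrite /H /cross ldu eqxx andbF.
have d_inj : {in X &, injective d}.
  move=> u u' uX u'X du; apply/eqP; apply: contraT => ne.
  have /andP[_ /eqP lu] := dP u uX; have /andP[_ /eqP lu'] := dP u' u'X.
  have := U_X u u' uX (subsetP XU _ u'X) ne.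
  by rewrite /H /cross -lu -lu' du eqxx andbF.
have d_adj u : u \in X -> d u \in N.
  move=> uX; have /andP[du /eqP ldu] := dP u uX.
  have /andP[Gvu lvu] := Hv u (subsetP XU u uX).
  rewrite inE /H /cross ldu lvu andbT; apply: contraT => Gvd.
  have vd : v != d u by apply: contraNneq lvu => ->; rewrite ldu.
  have [Q [Q_cl Q_card Q_adj]] := common_clique Gmax l_good vd Gvd.
  have /Q_adj/andP[_] : u \in Q.
    have /bigcapP := uX; apply; rewrite inE -/H Q_cl Q_card eqxx.
    by apply/subsetP => q /Q_adj/andP[]; rewrite inE.
  by rewrite /cross ldu eqxx andbF.
(* The twins are distinct neighbours of [v] outside [U], so with [haj] the degree of [v] reaches
   [2 * (t - 2)], against [low]. *)
have : #|U| + #|X| <= deg H v.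
  rewrite -(card_in_imset d_inj) -cardsUI.
  have -> : U :&: d @: X = set0.
    apply/setP => x; rewrite !inE; apply/negP => /andP[xU /imsetP[u uX xE]].
    by have := d_new u uX; rewrite -xE xU.
  rewrite cards0 addn0; apply/subset_leq_card; rewrite subUset FN.
  by apply/subsetP => _ /imsetP[u uX ->]; apply: d_adj.
lia.
Qed.

(** * Counting by label classes *)

Lemma transversal_exists (V : finType) (l : V -> V) (S : {set V}) :
  exists R : {set V}, [/\ R \subset S, {in R &, injective l} &
    S \subset \bigcup_(r in R) fiber l r].
Proof.
pose ok : pred {set V} := fun R => (R \subset S) && (#|l @: R| == #|R|).
have ok0 : ok set0 by rewrite /ok sub0set imset0 !cards0.
have [R /andP[sRS /imset_injP R_inj] R_max] := arg_maxnP (fun R : {set V} => #|R|) ok0.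
exists R; split=> //; apply/subsetP => x xS; apply/bigcupP.
have [/imsetP[r rR lx] | lx] := boolP (l x \in l @: R).
  by exists r; rewrite // in_fiber lx.
have xR : x \notin R by apply: contra lx; apply: imset_f.
have /R_max : ok (x |: R).
  by rewrite /ok subUset sub1set xS sRS imsetU1 !cardsU1 lx xR (card_in_imset R_inj) eqxx.
by rewrite /= cardsU1 xR add1n ltnn.
Qed.

Lemma transversal_sum (V : finType) (l : V -> V) (R : {set V}) (F : V -> nat) :
  {in R &, injective l} -> \sum_(r in R) \sum_(x in fiber l r) F x <= \sum_x F x.
Proof.
move=> R_inj; rewrite (exchange_big_dep xpredT) //=; apply: leq_sum => x _.
rewrite sum_nat_cond_const -[leqRHS]mul1n leq_mul2r; apply/orP; right.
apply/card_le1_eqP => r s; rewrite !inE => /andP[rR /eqP xr] /andP[sR /eqP xs].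
by apply: R_inj => //; rewrite -xr.
Qed.

(** The cases are whether or not low-degree vertices meet at most [g] classes. If they meet more,
    these disjoint classes each have total degree at least [#|V| - 1]. *)
Lemma low_degree_few (V : finType) (G : sgraph V) (t k g : nat) (l : V -> V) :
  2 < k -> edge_maximal G t k -> good_labelling G t k l ->
  #|[set x | deg (cross G l) x < 2 * (t - 2)]| <= g * k \/
  g * #|V| <= \sum_x deg G x + g.
Proof.
move=> k_gt2 Gmax l_good; have [l_fib l_cl] := l_good.
set L := [set x | _]; have [R [sRL R_inj LR]] := transversal_exists l L.
have [Rg | gR] := leqP #|R| g; [left | right].
  apply: leq_trans (subset_leq_card LR) _.
  apply: (@leq_trans (#|R| * k)); last by rewrite leq_mul2r Rg orbT.
  by apply: card_bigcup_le => r _; apply: ltnW.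
have : \sum_(r in R) #|V| <= \sum_(r in R) (\sum_(b in fiber l r) deg G b).+1.
  apply: leq_sum => r /(subsetP sRL); rewrite inE => low.
  exact: low_degree_class Gmax l_good low.
have := transversal_sum (deg G) R_inj.
under [X in _ -> _ <= X -> _]eq_bigr do rewrite -addn1.
rewrite big_split /= !sum_nat_const; set D := \sum_x _; set E := \sum_(r in R) _; nia.
Qed.

(** By [fibers_large], representatives of distinct small classes are adjacent, hence form a red
    clique. *)
Lemma small_fibers_few (V : finType) (G : sgraph V) (t k : nat) (l : V -> V) :
  edge_maximal G t k -> good_labelling G t k l ->
  #|[set x | 2 * #|fiber l x| < k]| <= t * k.
Proof.
move=> Gmax l_good; have [l_fib l_cl] := l_good.
set S := [set x | _]; have [R [sRS R_inj SR]] := transversal_exists l S.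
apply: leq_trans (subset_leq_card SR) _.
have Rt : #|R| <= t.
  apply/ltnW/l_cl/cliqueP => x y xR yR ne.
  rewrite /cross (contra_neq _ ne) ?andbT; last exact: R_inj.
  apply: contraT => Gxy; have := fibers_large Gmax l_good ne Gxy.
  have := subsetP sRS x xR; have := subsetP sRS y yR; rewrite !inE; lia.
apply: (@leq_trans (#|R| * k)); last by rewrite leq_mul2r Rt orbT.
by apply: card_bigcup_le => r _; apply: ltnW.
Qed.

(** Classes are cliques, so the blue neighbours of [x] are the rest of its class. *)
Lemma deg_cross (V : finType) (G : sgraph V) (t k : nat) (l : V -> V) (x : V) :
  edge_maximal G t k -> good_labelling G t k l ->
  deg G x = deg (cross G l) x + #|fiber l x|.-1.
Proof.
move=> Gmax l_good; rewrite /deg -(cardsID (fiber l x) [set y | G x y]) addnC.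
congr (_ + _); first by apply: eq_card => y; rewrite !inE eq_sym andbC.
rewrite (cardsD1 x (fiber l x)) fiber_id /=; apply: eq_card => y; rewrite !inE.
have [-> | yx] := eqVneq y x; first by rewrite adj_irr.
rewrite andbC; case: eqP => //= ly.
by rewrite (fiber_clique Gmax l_good) // eq_sym.
Qed.

Lemma co_critical_edges (t k : nat) (ht : 4 <= t) (hk : 6 <= k) :
  exists C : nat, forall (V : finType) (G : sgraph V), co_critical G t k ->
    (4 * t - 9 + uphalf k) * #|V| <= 2 * #|edges G| + C.
Proof.
(* Here [g = 2 * d + (uphalf k).-1] is twice the desired coefficient: [2 * d] for red degrees, the
   rest for blue ones. It also serves as the threshold on low-degree classes. *)
pose d := 2 * (t - 2); pose g := 4 * t - 9 + uphalf k.
(* The summands pay for the case of many low-degree classes, the loss in the red count, and the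
   vertices in small classes. *)
exists (g + 2 * d * (g * k + (2 * d * d).+1 * (avoid_bound d d * k)) + uphalf k * (t * k)).
move=> V G Gcrit; have k_gt0 : 0 < k by lia.
have Gmax := co_critical_maximal k_gt0 Gcrit.
have [_ /(arrowsPn _ _ k_gt0)[l l_good] _] := Gcrit; have [l_fib l_cl] := l_good.
have edgesE := sum_deg_le G.
have k_gt2 : 2 < k by lia.
have [low | many] := low_degree_few g k_gt2 Gmax l_good; last first.
  by apply: leq_trans many _; apply: leq_add edgesE _; rewrite -[leqRHS]addnA leq_addr.
have := @min_degree_sum V (cross G l) l d k (cross_sym G l) (fun x => ltnW (l_fib x)).
move/(_ (fun x y z => cross_saturated Gmax l_good)).
have := small_fibers_few Gmax l_good.
have degE : \sum_x deg G x = \sum_x deg (cross G l) x + \sum_x #|fiber l x|.-1.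
  by rewrite -big_split; apply: eq_bigr => x _; apply: deg_cross Gmax l_good.
set S := [set x | 2 * #|fiber l x| < k] => S_few.
(* A class with at least half of [k] vertices has at least [uphalf k] of them. *)
have blue : (uphalf k).-1 * #|~: S| <= \sum_x #|fiber l x|.-1.
  rewrite mulnC -sum_nat_const [leqRHS](bigID (mem S)) /=.
  apply: leq_trans (leq_addl _ _).
  rewrite [leqLHS](eq_bigl (fun x => x \notin S)); last by move=> x; rewrite inE.
  apply: leq_sum => x; rewrite inE -leqNgt; lia.
have := cardsC S.
move: low; rewrite -/d; set L := #|_|.
move: degE blue edgesE S_few.
set D := \sum_x deg G x; set D' := \sum_x deg (cross G l) x; set B := \sum_x _.-1.
set s := #|S|; set s' := #|~: S|; set c := (2 * d * d).+1 * _; set n := #|V|.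
move=> degE blue edgesE S_few low sn day.
have u_gt0 : 0 < uphalf k by lia.
have gE : g = 2 * d + (uphalf k).-1 by rewrite /g /d; lia.
rewrite -/g.
have h1 : g * n = 2 * d * n + (uphalf k).-1 * s + (uphalf k).-1 * s'.
  by rewrite gE -sn; ring.
have h2 : (uphalf k).-1 * s <= uphalf k * (t * k) by apply: leq_mul => //; lia.
have h3 : 2 * d * (L + c) <= 2 * d * (g * k + c) by rewrite leq_mul2l leq_add2r low orbT.
lia.
Qed.

(** * The bound in rational form *)

Import Order.TTheory GRing.Theory Num.Theory.
Local Open Scope ring_scope.

Lemma ceil_half (k : nat) : Num.ceil (k%:R / 2 : rat) = (uphalf k)%:Z.
Proof.
apply: ceil_def.
have : k = (uphalf k).*2 \/ k.+1 = (uphalf k).*2 by lia.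
rewrite rmorphB /= -!pmulrn.
case=> /(congr1 (fun m => m%:R : rat)); rewrite -?[k.+1]addn1 ?natrD -muln2 natrM; lra.
Qed.

Theorem theorem1p6 (t k : nat) (ht : (4 <= t)%N) (hk : (maxn 6 t <= k)%N) :
  exists l : rat,
    forall n : nat, ((t - 1) * (k - 1) + 1 <= n)%N ->
    forall (V : finType) (G : sgraph V), #|V| = n -> co_critical G t k ->
      #|edges G|%:R >=
        ((4 * t%:R - 9) / 2 + 2^-1 * (Num.ceil (k%:R / 2 : rat))%:~R) * n%:R - l.
Proof.
have hk6 : (6 <= k)%N by rewrite (leq_trans _ hk) ?leq_maxl.
have [C CP] := co_critical_edges ht hk6.
(* The constant is halved, as the integer bound concerns twice the number of edges; [4 <= t] makes
   the subtraction in [4 * t - 9] exact. *)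
exists (C%:R / 2) => n _ V G <- /CP.
rewrite -(ler_nat rat) ceil_half -pmulrn natrD !natrM natrD natrB; last by lia.
rewrite natrM; lra.
Qed.
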